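(* For a positive integer $n$, let $ex(n,K_3,C_5)$ denote the maximum possible number of triangles in a (simple) graph on $n$ vertices that does not contain a cycle of length five as a (not necessarily induced) subgraph. Then $$ex(n,K_3,C_5) < (1+o(1))\frac{1}{3\sqrt{2}}\, n^{3/2},$$ where $o(1)$ denotes a quantity tending to $0$ as $n\to\infty$.
   Context: A triangle is a copy of $K_3$ (three pairwise adjacent vertices). $C_5$ denotes the cycle of length five; a graph is $C_5$-free if it contains no $C_5$ as a subgraph. *)

(* Defs.v *)
From mathcomp Require Import all_boot.

Set Implicit Arguments.
Unset Strict Implicit.
Unset Printing Implicit Defensive.

Section Graphs.
Variable V : finType.

(* A simple graph on V is given by its set of edges, each edge being an
   unordered pair of distinct vertices. *)
Definition simple_graph (E : {set {set V}}) : bool :=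
  [forall e in E, #|e| == 2].

Definition adj (E : {set {set V}}) : rel V :=
  fun x y => [set x; y] \in E.

Definition triangles (E : {set {set V}}) : {set {set V}} :=
  [set T : {set V} | (#|T| == 3) &&
    [forall x in T, forall y in T, (x != y) ==> adj E x y]].

(* [ucycleb] asks for pairwise distinct vertices, consecutive ones being
   adjacent cyclically; chords are allowed, so this is the absence of C_5 as a
   not necessarily induced subgraph. *)
Definition C5_free (E : {set {set V}}) : bool :=
  ~~ [exists c : 5.-tuple V, ucycleb (adj E) c].

End Graphs.

(* The range of the maximum is never empty: it contains the edgeless graph. *)
Definition ex_K3_C5 (n : nat) : nat :=
  \max_(E : {set {set 'I_n}} | simple_graph E && C5_free E) #|triangles E|.

(* Main.v *)
(* Keep only the edges lying in triangles, and let f v be the number of 2-walks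
   from v.  If Q is a K4, or a triangle in no K4, the absence of 5-cycles makes
   the second neighbourhoods of the vertices of Q overlap so little that
   sum_(v in Q) f v <= 2 n + O(sum_(v in Q) deg v).  Every edge lies either in a
   unique K4 or only in triangles at least two sides of which lie in no other
   triangle.  Applying AM-GM inside each K4 and each triangle, the number W of
   5-walks (the sum of f x * f y over ordered adjacent pairs) is at most
   n^2 (5/2 e - 3 t) + O(n^3) for e edges and t triangles; the errors add up to
   O(n sum_v (deg v)^2) = O(n^3), with no bound on the maximum degree.
   Conversely W >= D^4 (10 e - 4 n D) for all D > 0, the tangent form of the
   Blakley-Roy bound W >= n (2e/n)^5.  For D = sqrt (n/2) the terms in e cancel
   and 3 t <= n D + O(n) remains. *)
Require Import Defs.
From mathcomp Require Import all_boot all_order all_algebra zify ring lra.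

Set Implicit Arguments.
Unset Strict Implicit.
Unset Printing Implicit Defensive.
Import Order.TTheory GRing.Theory Num.Theory.

Local Open Scope ring_scope.

(** * The arithmetic-geometric mean inequality in tangent form *)

(** After scaling by [D] only the mean [u] of [D/p], [D/q], [D/r], [D/s] matters: AM-GM bounds their
    product by [u^4], and [5 - 4u] is the tangent of [u^-4] at [u = 1]. Equality holds at
    [p = q = r = s = D]. *)
Lemma AGM5 (R : realFieldType) (D p q r s : R) :
  0 < D -> 0 < p -> 0 < q -> 0 < r -> 0 < s ->
  D ^+ 4 * (5 - D * (p^-1 + q^-1 + r^-1 + s^-1)) <= p * q * (r * s).
Proof.
move=> D0 p0 q0 r0 s0.
have [x0 y0] : 0 < D / p /\ 0 < D / q by split; apply: divr_gt0.
have [z0 w0] : 0 < D / r /\ 0 < D / s by split; apply: divr_gt0.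
rewrite (_ : D * _ = D / p + D / q + D / r + D / s); last by rewrite !mulrDr.
have -> : p * q * (r * s) = D ^+ 4 / (D / p * (D / q) * ((D / r) * (D / s))).
  by field; rewrite !gt_eqF.
set x := D / p in x0 *; set y := D / q in y0 *; set z := D / r in z0 *; set w := D / s in w0 *.
rewrite ler_pM2l ?exprn_gt0 //.
have P0 : 0 < x * y * (z * w) by apply: mulr_gt0; apply: mulr_gt0.
rewrite -[leRHS]mul1r ler_pdivlMr //.
pose u := (x + y + z + w) / 4; have u0 : 0 < u by rewrite /u; lra.
have -> : 5 - (x + y + z + w) = 5 - 4 * u by rewrite /u; lra.
have Pu : x * y * (z * w) <= u ^+ 4.
  have xy : x * y <= ((x + y) / 2) ^+ 2 by have := sqr_ge0 (x - y); rewrite !expr2; lra.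
  have zw : z * w <= ((z + w) / 2) ^+ 2 by have := sqr_ge0 (z - w); rewrite !expr2; lra.
  have mid : (x + y) / 2 * ((z + w) / 2) <= u ^+ 2.
    by have := sqr_ge0 (x + y - z - w); rewrite /u !expr2; lra.
  have le_sq := ler_pM (ltW (mulr_gt0 x0 y0)) (ltW (mulr_gt0 z0 w0)) xy zw.
  apply: le_trans le_sq _; rewrite -exprMn (exprM u 2 2) lerXn2r ?nnegrE ?exprn_ge0 ?(ltW u0) //.
  by apply: mulr_ge0; lra.
have u_ineq : (5 - 4 * u) * u ^+ 4 <= 1.
  rewrite -subr_ge0.
  have -> : 1 - (5 - 4 * u) * u ^+ 4 = (u - 1) ^+ 2 * (4 * u ^+ 3 + 3 * u ^+ 2 + 2 * u + 1) by ring.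
  rewrite mulr_ge0 ?sqr_ge0 //.
  by have := exprn_ge0 3 (ltW u0); have := exprn_ge0 2 (ltW u0); lra.
case: (leP 0 (5 - 4 * u)) => [u54|u54].
  by apply: le_trans u_ineq; apply: ler_wpM2l.
by apply: le_trans (ler01); apply: mulr_le0_ge0; apply: ltW.
Qed.

Local Close Scope ring_scope.

(* Consecutive vertices are automatically distinct when a is irreflexive. *)
Definition no_C5 (V : Type) (a : V -> V -> bool) := forall u v w x y,
  a u v -> a v w -> a w x -> a x y -> a y u ->
  u <> w -> u <> x -> v <> x -> v <> y -> w <> y -> False.

(** * Codegrees and second neighbourhoods *)

Section Graph.
Variables (V : finType) (a : rel V).
Hypothesis a_sym : symmetric a.
Hypothesis a_irr : irreflexive a.
Hypothesis a_C5 : no_C5 a.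

Definition deg v := #|[set x | a v x]|.
Definition common u v := [set x | a u x && a v x].
Definition codeg u v := #|common u v|.
Definition walks2 v := \sum_(x | a v x) deg x.

Lemma adj_neq u v : a u v -> u <> v.
Proof. by move=> uv E; rewrite E a_irr in uv. Qed.

Lemma commonC u v : common u v = common v u.
Proof. by apply/setP => x; rewrite !inE andbC. Qed.

Lemma codegC u v : codeg u v = codeg v u.
Proof. by rewrite /codeg commonC. Qed.

Lemma degE v : deg v = \sum_x a v x.
Proof.
rewrite /deg -sum1_card big_mkcond /=; apply: eq_bigr => x _.
by rewrite inE; case: (a v x).
Qed.

Lemma codegE u v : codeg u v = \sum_x (a u x && a v x).
Proof.
rewrite /codeg -sum1_card big_mkcond /=; apply: eq_bigr => x _.
by rewrite inE; case: (_ && _).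
Qed.

Lemma walks2E v : walks2 v = \sum_y codeg v y.
Proof.
under [RHS]eq_bigr do rewrite codegE.
rewrite exchange_big /= /walks2 big_mkcond /=; apply: eq_bigr => x _.
case: (a v x); last by rewrite big1.
by rewrite degE; apply: eq_bigr => y _; rewrite a_sym.
Qed.

Lemma card_gt1_neq (A : {set V}) x : 1 < #|A| -> exists2 y, y \in A & y <> x.
Proof.
move=> A1; have: 0 < #|A :\ x| by rewrite (cardsD1 x A) in A1; case: (x \in A) A1 => //=; lia.
by case/card_gt0P => y; rewrite !inE => /andP[/eqP yx yA]; exists y.
Qed.

Lemma card_gt2_neq (A : {set V}) x x' : 2 < #|A| -> exists y, [/\ y \in A, y <> x & y <> x'].
Proof.
move=> A1; have: 1 < #|A :\ x| by rewrite (cardsD1 x A) in A1; case: (x \in A) A1 => //=; lia.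
by case/(@card_gt1_neq _ x') => y; rewrite !inE => /andP[/eqP yx yA]; exists y.
Qed.

(* Otherwise the link of v contains a path on four vertices, which closes up
   to a 5-cycle through [v]. *)
Lemma link_degree v y z : a v y -> a v z -> a y z ->
  codeg v y <= 2 \/ codeg v z <= 2.
Proof.
move=> vy vz yz; case: (leqP (codeg v y) 2) => [|cy]; [by left|].
case: (leqP (codeg v z) 2) => [|cz]; [by right|].
case: (@card_gt1_neq _ z (ltnW cy)) => y'; rewrite inE => /andP[vy' yy'] ny'.
case: (card_gt2_neq y y' cz) => z' [+ nz' nz'']; rewrite inE => /andP[vz' zz'].
exfalso; apply: (a_C5 (u := v) (v := y') (w := y) (x := z) (y := z')) => //.
- by rewrite a_sym.
- by rewrite a_sym.
- exact: adj_neq.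
- exact: adj_neq.
- by move=> E; apply: nz''.
- by move=> E; apply: nz'.
Qed.

(** By [link_degree] every edge of the link of [v] has an end of link degree at most 2. Charging
    both orderings of the edge to that end costs each neighbour of [v] at most [2 + 2]. *)
Lemma sum_link v : \sum_(y | a v y) codeg v y <= 4 * deg v.
Proof.
have cE y : codeg v y = \sum_(z | a v z) a y z.
  rewrite codegE [RHS]big_mkcond; apply: eq_bigr => z _.
  by case: (a v z).
pose s y := if codeg v y <= 2 then codeg v y else 0.
have s2 : \sum_(y | a v y) s y <= 2 * deg v.
  rewrite /deg -sum1dep_card big_distrr /=; apply: leq_sum => y _.
  by rewrite /s; case: ifP.
have : \sum_(y | a v y) codeg v y
   <= \sum_(y | a v y) s y + \sum_(z | a v z) s z.
  pose p y := (codeg v y <= 2 : nat).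
  have -> : \sum_(y | a v y) s y = \sum_(y | a v y) \sum_(z | a v z) p y * a y z.
    apply: eq_bigr => y _; rewrite -big_distrr /= -cE /s /p.
    by case: ifP; rewrite ?mul1n.
  rewrite {2}exchange_big /= -big_split /=.
  apply: leq_sum => y vy; rewrite -big_split /= cE.
  apply: leq_sum => z vz; rewrite (a_sym z y).
  case yz: (a y z) => //=; rewrite !muln1 /p.
  by case: (link_degree vy vz yz) => ->; lia.
lia.
Qed.

Hypothesis a_tri : forall u v, a u v -> exists w, a u w && a v w.

(** If two common neighbours [x], [x'] were not adjacent, the third vertex [w] of a triangle on
    [v x] would close the 5-cycle [v w x y x']. So three common neighbours are pairwise adjacent,
    and [v x1 x2 y x3] is a 5-cycle. *)
Lemma codeg_nonadj v y : v <> y -> ~~ a v y -> codeg v y <= 2.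
Proof.
move=> vy nvy; rewrite leqNgt; apply/negP => /card_gt2P[x1 [x2 [x3 [[]]]]].
rewrite !inE => /andP[v1 y1] /andP[v2 y2] /andP[v3 y3] [/eqP n12 /eqP n23 /eqP n31].
have adj12 x x' : a v x -> a y x -> a v x' -> a y x' -> x <> x' -> a x x'.
  move=> vx yx vx' yx' xx'; apply/negPn/negP => nxx'.
  have [w /andP[vw xw]] := a_tri vx.
  apply: (a_C5 (u := v) (v := w) (w := x) (x := y) (y := x')) => //;
    try (by rewrite a_sym); try exact: adj_neq.
  - by move=> E; rewrite E (negbTE nvy) in vw.
  - by move=> E; rewrite -E xw in nxx'.
apply: (a_C5 (u := v) (v := x1) (w := x2) (x := y) (y := x3)) => //;
  try (by rewrite a_sym); try exact: adj_neq; try exact: adj12; try exact: nesym.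
by apply/nesym/adj_neq.
Qed.

(* Two walks v-x-y, v'-x'-y with v <> v' and x <> x' close up to a 5-cycle
   through the edge v v', so all these walks share v or all share x. *)
Lemma clique_walks2_to (Q : {set V}) y :
  {in Q &, forall u v, u != v -> a u v} ->
  (forall x, x \notin Q -> #|[set v in Q | a v x]| <= 2) ->
  y \notin Q ->
  \sum_(v in Q) #|common v y :\: Q| <= 2 + \sum_(v in Q | a v y) codeg v y.
Proof.
move=> Qclique Qout yQ.
have [P0|[[v0 x0] P0]] := set_0Vmem [set p : V * V | (p.1 \in Q) && (p.2 \in common p.1 y :\: Q)].
  rewrite big1 // => v vQ; apply/eqP; rewrite cards_eq0; apply/eqP/setP => x.
  by have /setP/(_ (v, x)) := P0; rewrite !inE /= vQ.
move: P0; rewrite !inE /= => /and4P[v0Q x0Q v0x0 yx0].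
have line v x : v \in Q -> x \notin Q -> a v x -> a y x ->
  forall v' x', v' \in Q -> x' \notin Q -> a v' x' -> a y x' ->
  v <> v' -> x = x'.
  move=> vQ xQ vx yx v' x' v'Q x'Q v'x' yx' vv'; apply/eqP/negPn/negP => /eqP xx'.
  apply: (a_C5 (u := v) (v := x) (w := y) (x := x') (y := v')) => //;
    try (by rewrite a_sym); try exact: adj_neq.
  - by apply: Qclique => //; apply/eqP/nesym.
  - by move=> E; rewrite -E vQ in yQ.
  - by move=> E; rewrite -E vQ in x'Q.
  - by move=> E; rewrite E v'Q in xQ.
  - by move=> E; rewrite E v'Q in yQ.
(* If a second vertex [v1] starts a walk, all walks pass through [x0], and [Qout] leaves at most two
   starting vertices. *)
case: (boolP [exists v1, exists x1, [&& v1 \in Q, x1 \notin Q, a v1 x1, a y x1 & v1 != v0]]).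
  case/existsP=> v1 /existsP[x1 /and5P[v1Q x1Q v1x1 yx1 /eqP v10]].
  have x10 : x1 = x0 by apply: (line v1 x1 _ _ _ _ v0 x0).
  subst x1.
  have all_x v x : v \in Q -> x \notin Q -> a v x -> a y x -> x = x0.
    move=> vQ xQ vx yx; case: (eqVneq v v0) => [vv0|/eqP vv0].
      by apply: (line v x _ _ _ _ v1 x0) => //; rewrite vv0; apply/nesym.
    by apply: (line v x _ _ _ _ v0 x0).
  apply: leq_trans (leq_addr _ _); apply: leq_trans (Qout _ x0Q).
  rewrite -sum1dep_card big_mkcondr /=; apply: leq_sum => v vQ.
  case: ifP => vx0.
    rewrite -(cards1 x0); apply/subset_leq_card/subsetP => x.
    by rewrite !inE => /and3P[xQ vx yx]; apply/eqP/(all_x v).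
  rewrite leqn0 cards_eq0; apply/eqP/setP => x; rewrite !inE.
  apply/negbTE/negP => /and3P[xQ vx yx].
  by rewrite -(all_x v x) // vx in vx0.
rewrite negb_exists => /forallP all_v.
rewrite (bigD1 v0) //= big1 ?addn0; last first.
  move=> v /andP[vQ vv0]; apply/eqP; rewrite cards_eq0; apply/eqP/setP => x; rewrite !inE.
  apply/negbTE/negP => /and3P[xQ vx yx].
  by have := all_v v; rewrite negb_exists => /forallP/(_ x); rewrite vQ xQ vx yx vv0.
(* Only [v0] starts a walk. Its codegree with [y] is a term on the right if [v0] and [y] are
   adjacent, and is at most 2 otherwise. *)
have le_c : #|common v0 y :\: Q| <= codeg v0 y by apply/subset_leq_card/subsetDl.
case: (boolP (a v0 y)) => v0y.
  rewrite (bigD1 v0) /=; last by rewrite v0Q.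
  by lia.
apply: leq_trans le_c _; apply: leq_trans (leq_addr _ _).
by apply: codeg_nonadj => // E; rewrite -E v0Q in yQ.
Qed.

(** The 2-walks are grouped by their end [y]. The main term is 2 for each [y]; the [12] collects 4
    from ends adjacent to the start ([sum_link]), 4 from walks with middle vertex in [Q], and 4 from
    ends in [Q]. *)
Lemma clique_walks2 (Q : {set V}) :
  #|Q| <= 4 ->
  {in Q &, forall u v, u != v -> a u v} ->
  (forall x, x \notin Q -> #|[set v in Q | a v x]| <= 2) ->
  \sum_(v in Q) walks2 v <= 2 * #|V| + 12 * \sum_(v in Q) deg v.
Proof.
move=> Q4 Qclique Qout.
have codeg_deg v y : codeg v y <= deg v.
  by apply/subset_leq_card/subsetP => x; rewrite !inE => /andP[].
have pointwise y : \sum_(v in Q) codeg v y <=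
  2 + \sum_(v in Q | a v y) codeg v y + 4 * (\sum_(x in Q) a x y)
  + (y \in Q) * \sum_(v in Q) deg v.
  case: (boolP (y \in Q)) => yQ.
    rewrite mul1n; apply: leq_trans (leq_addl _ _).
    exact: leq_sum.
  rewrite mul0n addn0.
  have -> : \sum_(v in Q) codeg v y =
      \sum_(v in Q) #|common v y :\: Q| + \sum_(v in Q) #|common v y :&: Q|.
    by rewrite -big_split /=; apply: eq_bigr => v _; rewrite addnC cardsID.
  apply: leq_add; first exact: clique_walks2_to.
  apply: leq_trans (_ : #|Q| * (\sum_(x in Q) a x y) <= _); last by rewrite leq_mul2r Q4 orbT.
  rewrite -sum_nat_const; apply: leq_sum => v vQ.
  rewrite -sum1_card big_mkcond [X in _ <= X]big_mkcond /=; apply: leq_sum => x _.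
  by rewrite !inE (a_sym y); case: (x \in Q); rewrite ?andbF //; case: (a v x); case: (a x y).
under eq_bigr do rewrite walks2E.
rewrite exchange_big /=; 
  apply: leq_trans (_ : _ <= \sum_y _) _; first by apply: leq_sum => y _; exact: pointwise.
rewrite !big_split /= sum_nat_const -big_distrl /= big1_eq.
have -> : #|(fun _ : V => true)| = #|V| by apply: eq_card.
have -> : \sum_(y : V) (y \in Q) = #|Q|.
  by rewrite -sum1_card [RHS]big_mkcond; apply: eq_bigr => y _; case: (y \in Q).
have -> : \sum_i \sum_(x in Q) a x i = \sum_(v in Q) deg v.
  by rewrite exchange_big; apply: eq_bigr => v _; rewrite degE.
have le_link : \sum_y \sum_(v in Q | a v y) codeg v y <= 4 * \sum_(v in Q) deg v.
  under eq_bigr do rewrite big_mkcondr /=.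
  rewrite exchange_big big_distrr /=; apply: leq_sum => v _.
  by rewrite -big_mkcond sum_link.
have := leq_mul Q4 (leqnn (\sum_(v in Q) deg v)).
lia.
Qed.

(** * Lone triangles and copies of [K4] *)

Definition K3 x y z := [&& a x y, a y z & a x z].
Definition K4 x y z w := [&& K3 x y z, a x w, a y w & a z w].
Definition lone_K3 x y z := K3 x y z && ~~ [exists w, K4 x y z w].

Lemma K3_rot x y z : K3 x y z = K3 y z x.
Proof. by rewrite /K3 (a_sym y x) (a_sym z x); case: (a x y); case: (a y z); case: (a x z). Qed.

Lemma K4_rot x y z w : K4 x y z w = K4 y z w x.
Proof.
rewrite /K4 /K3 (a_sym y x) (a_sym z x) (a_sym w x).
by case: (a x y); case: (a y z); case: (a x z); case: (a x w); case: (a y w); case: (a z w).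
Qed.

Lemma K4_swap23 x y z w : K4 x y z w = K4 x z y w.
Proof.
rewrite /K4 /K3 (a_sym z y).
by case: (a x y); case: (a y z); case: (a x z); case: (a x w); case: (a y w); case: (a z w).
Qed.

Lemma K4_swap34 x y z w : K4 x y z w = K4 x y w z.
Proof.
rewrite /K4 /K3 (a_sym w z).
by case: (a x y); case: (a y z); case: (a x z); case: (a x w); case: (a y w); case: (a z w).
Qed.

Lemma lone_K3_rot x y z : lone_K3 x y z = lone_K3 y z x.
Proof.
rewrite /lone_K3 (K3_rot x y z); congr (_ && ~~ _); apply/existsP/existsP => -[w k]; exists w.
  by rewrite K4_swap34 -K4_rot.
by rewrite K4_rot K4_swap34.
Qed.

(** A further common neighbour [u] of [x] and [y] would close the 5-cycle [u x z w y]. *)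
Lemma K4_common x y z w : K4 x y z w -> common x y = [set z; w].
Proof.
move=> /and4P[/and3P[xy yz xz] xw yw zw]; apply/setP => u; rewrite !inE.
apply/andP/orP => [[xu yu]|[/eqP->|/eqP->]] //.
case: (eqVneq u z) => [_|/eqP uz]; [by left | right]; apply/negPn/negP => /eqP uw.
apply: (a_C5 (u := u) (v := x) (w := z) (x := w) (y := y)) => //;
  try (by rewrite a_sym); try exact: adj_neq.
by apply/nesym/adj_neq.
Qed.

Lemma K4_codeg x y z w : K4 x y z w -> codeg x y = 2.
Proof.
move=> k; rewrite /codeg (K4_common k) cards2; case/and4P: k => _ _ _ zw.
by have /eqP -> := adj_neq zw.
Qed.

(** Let [u] and [v] complete further triangles on [x y] and [x z]. If [u = v] there is a [K4],
    otherwise [u y z v x] is a 5-cycle. Over the three rotations, at least two sides have codegree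
    1. *)
Lemma lone_K3_codeg x y z : lone_K3 x y z -> codeg x y = 1 \/ codeg z x = 1.
Proof.
case/andP=> /and3P[xy yz xz] /existsP nK; rewrite (codegC z).
have codeg_gt0 u : a x u -> 0 < codeg x u.
  by move/a_tri => [w xuw]; apply/card_gt0P; exists w; rewrite inE.
case: (ltnP 1 (codeg x y)) => [c1|]; last by move: (codeg_gt0 _ xy); lia.
case: (ltnP 1 (codeg x z)) => [c2|]; last by move: (codeg_gt0 _ xz); lia.
case: (card_gt1_neq z c1) => u; rewrite inE => /andP[xu yu] uz.
case: (card_gt1_neq y c2) => v; rewrite inE => /andP[xv zv] vy.
exfalso; case: (eqVneq u v) => [uv|/eqP uv].
  by apply: nK; exists u; rewrite /K4 /K3 xy yz xz xu yu uv zv.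
apply: (a_C5 (u := u) (v := y) (w := z) (x := v) (y := x)) => //;
  try (by rewrite a_sym); try exact: nesym.
  by apply/nesym/adj_neq.
by apply/nesym/adj_neq.
Qed.

(** By [K4_common] a triangle extends to a [K4] by at most one vertex, so the sum is 0 or 1. *)
Lemma K3_split x y z :
  K3 x y z = lone_K3 x y z + \sum_w K4 x y z w :> nat.
Proof.
rewrite /lone_K3; case: (boolP [exists w, K4 x y z w]) => [/existsP[w0 k0]|].
  have [k3 _ _ zw0] := and4P k0; rewrite k3 (bigD1 w0) //= k0 big1 // => w ww0.
  apply/eqP; rewrite eqb0; apply/negP => k.
  have := K4_common k; rewrite (K4_common k0) => /setP/(_ w).
  rewrite !inE eqxx orbT (negbTE ww0) orbF => /eqP E.
  by case/and4P: k => _ _ _; rewrite E a_irr.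
rewrite negb_exists andbT => /forallP nK; rewrite big1 ?addn0 // => w _.
by rewrite (negbTE (nK w)).
Qed.

Lemma sum_K3 x y : a x y -> \sum_z K3 x y z = codeg x y.
Proof.
by move=> xy; rewrite codegE; apply: eq_bigr => z _; rewrite /K3 xy /= andbC.
Qed.

(** An edge of a [K4] has codegree 2, and both its triangles lie in that [K4]; the final [2] counts
    the two orders of the remaining vertices. *)
Lemma edge_lone_or_K4 x y : a x y ->
  [/\ 0 < codeg x y, \sum_z lone_K3 x y z = codeg x y & \sum_z \sum_w K4 x y z w = 0]
  \/ [/\ \sum_z lone_K3 x y z = 0 & \sum_z \sum_w K4 x y z w = 2].
Proof.
move=> xy; have := sum_K3 xy.
under eq_bigr do rewrite K3_split.
rewrite big_split /=.
case: (boolP [exists z, exists w, K4 x y z w]) => [/existsP[z /existsP[w k]]|nK].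
  rewrite (K4_codeg k) => E; right.
  suff E0 : \sum_z lone_K3 x y z = 0 by rewrite E0 in E *; split.
  apply: big1 => u _; apply/eqP; rewrite eqb0; apply/negP => /andP[/and3P[_ yu xu] /existsP]; apply.
  have : u \in common x y by rewrite inE xu.
  rewrite (K4_common k) !inE => /orP[/eqP->|/eqP->]; [by exists w | by exists z; rewrite K4_swap34].
have -> : \sum_z \sum_w K4 x y z w = 0.
  apply: big1 => z _; apply: big1 => w _; apply/eqP; rewrite eqb0.
  by apply: contra nK => k; apply/existsP; exists z; apply/existsP; exists w.
rewrite addn0 => E; left; split=> //.
by have [w xyw] := a_tri xy; apply/card_gt0P; exists w; rewrite inE.
Qed.

(** Walks of length two, counted by middle vertex and by first vertex. *)
Lemma sum_sqr_deg : \sum_x deg x ^ 2 = \sum_x walks2 x.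
Proof.
rewrite /walks2; under [RHS]eq_bigr do rewrite big_mkcond /=.
rewrite exchange_big /=; apply: eq_bigr => x _.
rewrite -big_mkcond /= sum_nat_const -mulnn; congr (_ * _).
by rewrite /deg cardsE; apply: eq_card => y; exact: a_sym.
Qed.

Lemma deg_le v : deg v <= #|V|.
Proof. exact: max_card. Qed.

(** The bound of [clique_walks2] for a one-vertex clique, with [14 = 2 + 12]. *)
Lemma walks2_le v : walks2 v <= 14 * #|V|.
Proof.
have := @clique_walks2 [set v]; rewrite cards1 !big_set1 => /(_ isT) H.
apply: leq_trans (H _ _) _.
- by move=> x y; rewrite !inE => /eqP-> /eqP->; rewrite eqxx.
- move=> x _; apply: leq_trans (_ : #|[set v]| <= _); last by rewrite cards1.
  by apply/subset_leq_card/subsetP => u; rewrite inE => /andP[].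
by move: (deg_le v); lia.
Qed.

(** A vertex adjacent to all three corners would complete a [K4], so [clique_walks2] applies. *)
Lemma K3_walks2 x y z : lone_K3 x y z ->
  walks2 x + walks2 y + walks2 z <= 2 * #|V| + 12 * (deg x + deg y + deg z).
Proof.
case/andP=> /and3P[xy yz xz] /existsP nK.
have E (F : V -> nat) : \sum_(v in [set x; y; z]) F v = F x + F y + F z.
  rewrite setUC big_setU1 ?big_setU1 ?big_set1 /= ?inE.
  - by rewrite addnC.
  - by apply/eqP/adj_neq.
  - by rewrite negb_or; apply/andP; split; apply/eqP/nesym/adj_neq.
have := @clique_walks2 [set x; y; z]; rewrite !E; apply.
- by rewrite -sum1_card E.
- by move=> u v; rewrite !inE => /orP[/orP[]|] /eqP-> /orP[/orP[]|] /eqP->; rewrite ?eqxx // a_sym.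
- move=> u uQ; rewrite -sum1dep_card big_mkcondr /= E.
  case xu: (a x u); case yu: (a y u); case zu: (a z u) => //.
  by case: nK; exists u; rewrite /K4 /K3 xy yz xz xu yu zu.
Qed.

(** By [K4_common] an outside vertex is adjacent to at most one of [x], [y] and at most one of [z],
    [w], so [clique_walks2] applies. *)
Lemma K4_walks2 x y z w : K4 x y z w ->
  walks2 x + walks2 y + walks2 z + walks2 w
    <= 2 * #|V| + 12 * (deg x + deg y + deg z + deg w).
Proof.
move=> k; have /and4P[/and3P[xy yz xz] xw yw zw] := k.
have E (F : V -> nat) : \sum_(v in [set x; y; z; w]) F v = F x + F y + F z + F w.
  have neq u v : a u v -> u != v by move=> uv; apply/eqP/adj_neq.
  have [nxy nyz nxz] := And3 (neq _ _ xy) (neq _ _ yz) (neq _ _ xz).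
  have [nxw nyw nzw] := And3 (neq _ _ xw) (neq _ _ yw) (neq _ _ zw).
  rewrite setUC big_setU1 /=; last by rewrite !inE !negb_or ![w == _]eq_sym nxw nyw.
  rewrite setUC big_setU1 /=; last by rewrite !inE !negb_or ![z == _]eq_sym nxz.
  by rewrite big_setU1 ?big_set1 ?inE //= addnC [F z + _]addnC.
have := @clique_walks2 [set x; y; z; w]; rewrite !E; apply.
- by rewrite -sum1_card E.
- move=> u v; rewrite !inE => /orP[/orP[/orP[]|]|] /eqP-> /orP[/orP[/orP[]|]|] /eqP->;
  by rewrite ?eqxx // a_sym.
- move=> u; rewrite !inE !negb_or -!andbA => /and4P[ux uy uz uw].
  rewrite -sum1dep_card big_mkcondr /= E.
  have only2 p q r s : K4 p q r s -> u != r -> u != s -> a p u -> a q u -> False.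
    move=> kk ur us pu qu; have : u \in common p q by rewrite inE pu.
    by rewrite (K4_common kk) !inE (negbTE ur) (negbTE us).
  have kzw : K4 z w x y by rewrite -2!K4_rot.
  case xu: (a x u); case yu: (a y u); try by case: (only2 _ _ _ _ k uz uw).
  all: case zu: (a z u); case wu: (a w u) => //; by case: (only2 _ _ _ _ kzw ux uy).
Qed.

(** * Lower bound on the number of 5-walks *)

Variable R : realFieldType.
Local Open Scope ring_scope.
Local Notation n := (#|V|%:R : R).
Local Notation A x y := ((a x y)%:R : R).
Local Notation d x := ((deg x)%:R : R).
Local Notation f x := ((walks2 x)%:R : R).
Local Notation c x y := ((codeg x y)%:R : R).
Local Notation N x y z := ((lone_K3 x y z)%:R : R).
Local Notation K x y z w := ((K4 x y z w)%:R : R).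

Definition walks5 : R := \sum_x \sum_y A x y * (f x * f y).

Lemma degR x : d x = \sum_y A x y.
Proof. by rewrite degE natr_sum. Qed.

Lemma walks2R x : f x = \sum_y A x y * d y.
Proof.
rewrite /walks2 natr_sum big_mkcond; apply: eq_bigr => y _.
by case: (a x y); rewrite ?mul1r ?mul0r.
Qed.

Lemma sum_adj_const x (k : R) : \sum_y A x y * k = d x * k.
Proof. by rewrite degR big_distrl. Qed.

Lemma sum_adj_swap (F : V -> V -> R) :
  \sum_x \sum_y A x y * F x y = \sum_x \sum_y A x y * F y x.
Proof.
rewrite exchange_big; apply: eq_bigr => x _; apply: eq_bigr => y _.
by rewrite a_sym.
Qed.

Lemma sum_inv_deg : \sum_x \sum_y A x y * (d x)^-1 <= n.
Proof.
rewrite -sum1_card natr_sum; apply: ler_sum => x _; rewrite sum_adj_const.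
(* An isolated vertex contributes 0, any other vertex exactly 1. *)
by have [->|d0] := eqVneq (d x) 0; rewrite ?mul0r ?ler01 ?divff.
Qed.

(** Cauchy-Schwarz in tangent form: [1/t >= 2l - l^2 t] for each [t = d y], where [1/l = f x / d x]
    is the mean degree of the neighbours of [x]. *)
Lemma sqr_deg_walks2 x : d x * (d x / f x) <= \sum_y A x y * (d y)^-1.
Proof.
have S_ge0 : 0 <= \sum_y A x y * (d y)^-1.
  by apply: sumr_ge0 => y _; rewrite mulr_ge0 ?invr_ge0.
have [f0|f0] := eqVneq (f x) 0; first by rewrite f0 invr0 !mulr0.
have {}f0 : 0 < f x by rewrite lt_def f0 ler0n.
pose l := d x / f x.
have -> : d x * (d x / f x) = \sum_y A x y * (2 * l - l ^+ 2 * d y).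
  under eq_bigr do rewrite mulrBr.
  rewrite big_split /= sum_adj_const sumrN.
  under eq_bigr do rewrite mulrCA.
  rewrite -mulr_sumr -walks2R /l; field; exact: lt0r_neq0.
apply: ler_sum => y _; case xy: (a x y); rewrite ?mul0r // !mul1r.
have d0 : 0 < d y.
  by rewrite ltr0n; apply/card_gt0P; exists x; rewrite inE a_sym.
have -> : (d y)^-1 = (2 * l - l ^+ 2 * d y) + (1 - l * d y) ^+ 2 / d y.
  by field; exact: lt0r_neq0.
by rewrite lerDl mulr_ge0 ?sqr_ge0 // invr_ge0 ltW.
Qed.

(** On each edge [AGM5] is applied to [d x], [f x / d x], [d y], [f y / d y], whose product is
    [f x * f y]. Each of the four sums of reciprocals is at most [n]. *)
Lemma walks5_ge (D : R) : 0 < D ->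
  D ^+ 4 * (5 * \sum_x d x - 4 * (n * D)) <= walks5.
Proof.
move=> D0.
pose F x y := D ^+ 4 * (5 - D * ((d x)^-1 + d x / f x + (d y)^-1 + d y / f y)).
have le1 : \sum_x \sum_y A x y * F x y <= walks5.
  apply: ler_sum => x _; apply: ler_sum => y _.
  case xy: (a x y); rewrite ?mul0r // !mul1r.
  have pos u v : a u v -> 0 < d u /\ 0 < f u.
    move=> uv; have dd u' v' : a u' v' -> 0 < d u'.
      by move=> uv'; rewrite ltr0n; apply/card_gt0P; exists v'; rewrite inE.
    split; first exact: dd uv.
    rewrite walks2R (bigD1 v) //= uv mul1r ltr_pwDl ?(dd v u) 1?a_sym //.
    by apply: sumr_ge0 => w _; rewrite mulr_ge0.
  have [dx fx] := pos _ _ xy; have [dy fy] : 0 < d y /\ 0 < f y by apply: (pos y x); rewrite a_sym.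
  have := AGM5 D0 dx (divr_gt0 fx dx) dy (divr_gt0 fy dy).
  rewrite !invf_div [d x * _]mulrC [d y * _]mulrC !divfK ?gt_eqF //.
apply: le_trans le1.
have -> : \sum_x \sum_y A x y * F x y = D ^+ 4 * (5 * (\sum_x d x)
   - D * (\sum_x \sum_y A x y * (d x)^-1 + \sum_x \sum_y A x y * (d x / f x)
     + \sum_x \sum_y A x y * (d x)^-1 + \sum_x \sum_y A x y * (d x / f x))).
  rewrite {2}(sum_adj_swap (fun x _ => (d x)^-1)) {2}(sum_adj_swap (fun x _ => d x / f x)).
  under [in RHS]eq_bigr do rewrite degR.
  rewrite !mulr_sumr -!big_split !mulr_sumr -sumrN -big_split !mulr_sumr; apply: eq_bigr => x _.
  rewrite !mulr_sumr -!big_split !mulr_sumr -sumrN -big_split !mulr_sumr; apply: eq_bigr => y _ /=.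
  rewrite /F; ring.
rewrite ler_pM2l ?exprn_gt0 //.
have S1 := sum_inv_deg.
have S2 : \sum_x \sum_y A x y * (d x / f x) <= n.
  apply: le_trans S1; rewrite [leRHS]sum_adj_swap; apply: ler_sum => x _.
  by rewrite sum_adj_const sqr_deg_walks2.
have := ler_wpM2l (ltW D0) S1; have := ler_wpM2l (ltW D0) S2.
lra.
Qed.

(** * Upper bound on the number of 5-walks *)

Lemma sum3_rot (F : V -> V -> V -> R) :
  \sum_x \sum_y \sum_z F x y z = \sum_x \sum_y \sum_z F y z x.
Proof.
rewrite [RHS]exchange_big; apply: eq_bigr => y _.
by rewrite [RHS]exchange_big.
Qed.

Lemma sum4_rot (F : V -> V -> V -> V -> R) :
  \sum_x \sum_y \sum_z \sum_w F x y z w = \sum_x \sum_y \sum_z \sum_w F y z w x.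
Proof.
rewrite [RHS]exchange_big; apply: eq_bigr => y _.
rewrite [RHS]exchange_big; apply: eq_bigr => z _.
by rewrite [RHS]exchange_big.
Qed.

Lemma sum4_swap23 (F : V -> V -> V -> V -> R) :
  \sum_x \sum_y \sum_z \sum_w F x y z w = \sum_x \sum_y \sum_z \sum_w F x z y w.
Proof. by apply: eq_bigr => x _; rewrite [RHS]exchange_big. Qed.

(** Rotating the ordered triangles shows that the three terms have equal totals, so an inequality on
    each triangle becomes one on the sum over edges. *)
Lemma sum_lone_K3_ge0 (H : V -> V -> R) :
  (forall x y z, lone_K3 x y z -> 0 <= H x y + H y z + H z x) ->
  0 <= \sum_x \sum_y \sum_z N x y z * H x y.
Proof.
move=> H0.
have E1 : \sum_x \sum_y \sum_z N x y z * H y z = \sum_x \sum_y \sum_z N x y z * H x y.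
  rewrite [RHS]sum3_rot; do 3!(apply: eq_bigr => ? _); by rewrite lone_K3_rot.
have E2 : \sum_x \sum_y \sum_z N x y z * H z x = \sum_x \sum_y \sum_z N x y z * H x y.
  rewrite -E1 [RHS]sum3_rot; do 3!(apply: eq_bigr => ? _); by rewrite lone_K3_rot.
have : 0 <= \sum_x \sum_y \sum_z N x y z * (H x y + H y z + H z x).
  do 3!(apply: sumr_ge0 => ? _); case E: lone_K3; rewrite ?mul0r // mul1r; exact: H0.
have -> : \sum_x \sum_y \sum_z N x y z * (H x y + H y z + H z x) =
  \sum_x \sum_y \sum_z N x y z * H x y + \sum_x \sum_y \sum_z N x y z * H y z
  + \sum_x \sum_y \sum_z N x y z * H z x.
  rewrite -!big_split; apply: eq_bigr => x _; rewrite -!big_split; apply: eq_bigr => y _.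
  by rewrite -!big_split; apply: eq_bigr => z _; rewrite /= !mulrDr.
rewrite E1 E2; lra.
Qed.

Lemma sum_K4_ge0 (H : V -> V -> R) :
  (forall x y z w, K4 x y z w -> 0 <= H x y + H y z + H z w + H w x + H x z + H y w) ->
  0 <= \sum_x \sum_y \sum_z \sum_w K x y z w * H x y.
Proof.
move=> H0; set S := (X in 0 <= X).
have E1 : \sum_x \sum_y \sum_z \sum_w K x y z w * H y z = S.
  rewrite /S [RHS]sum4_rot; do 4!(apply: eq_bigr => ? _); by rewrite K4_rot.
have E2 : \sum_x \sum_y \sum_z \sum_w K x y z w * H z w = S.
  rewrite -E1 [RHS]sum4_rot; do 4!(apply: eq_bigr => ? _); by rewrite K4_rot.
have E3 : \sum_x \sum_y \sum_z \sum_w K x y z w * H w x = S.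
  rewrite -E2 [RHS]sum4_rot; do 4!(apply: eq_bigr => ? _); by rewrite K4_rot.
have E4 : \sum_x \sum_y \sum_z \sum_w K x y z w * H x z = S.
  rewrite /S [RHS]sum4_swap23; do 4!(apply: eq_bigr => ? _); by rewrite K4_swap23.
have E5 : \sum_x \sum_y \sum_z \sum_w K x y z w * H y w = S.
  rewrite -E4 [RHS]sum4_rot; do 4!(apply: eq_bigr => ? _); by rewrite K4_rot.
have : 0 <= \sum_x \sum_y \sum_z \sum_w K x y z w *
    (H x y + H y z + H z w + H w x + H x z + H y w).
  do 4!(apply: sumr_ge0 => ? _); case E: K4; rewrite ?mul0r // mul1r; exact: H0.
have -> : \sum_x \sum_y \sum_z \sum_w K x y z w * (H x y + H y z + H z w + H w x + H x z + H y w) =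
  S + S + S + S + S + S.
  rewrite -{2}E1 -{2}E2 -{2}E3 -{2}E4 -{2}E5 /S.
  rewrite -!big_split; apply: eq_bigr => x _; rewrite -!big_split; apply: eq_bigr => y _.
  rewrite -!big_split; apply: eq_bigr => z _; rewrite -!big_split; apply: eq_bigr => w _.
  by rewrite /= !mulrDr.
lra.
Qed.

(** An edge outside every [K4] is shared among its [c x y] lone triangles; an edge of a [K4] is met
    twice, once per order of [z] and [w]. *)
Lemma sum_adj_split (g : V -> V -> R) :
  \sum_x \sum_y A x y * g x y =
  \sum_x \sum_y \sum_z N x y z * (g x y / c x y)
  + 2^-1 * \sum_x \sum_y \sum_z \sum_w K x y z w * g x y.
Proof.
rewrite mulr_sumr -big_split; apply: eq_bigr => x _.
rewrite mulr_sumr -big_split; apply: eq_bigr => y _ /=.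
under [X in _ + _ * X]eq_bigr do rewrite -big_distrl /=.
rewrite -!big_distrl /=.
under [X in _ + _ * (X * _)]eq_bigr do rewrite -natr_sum.
rewrite -!natr_sum; case xy: (a x y); last first.
  rewrite !big1 ?mul0r ?mulr0 ?addr0 // => z _.
    by rewrite big1 // => w _; rewrite /K4 /K3 xy.
  by rewrite /lone_K3 /K3 xy.
case: (edge_lone_or_K4 xy) => [[c0 -> ->]|[-> ->]].
  by rewrite !mul0r mulr0 addr0 mul1r mulrCA divff ?mulr1 // pnatr_eq0 -lt0n.
by rewrite mul0r add0r mul1r mulrA mulVf ?mul1r // pnatr_eq0.
Qed.

(* Since [\sum_x \sum_y A x y = \sum N / c + \sum K / 2] and the number of ordered
   triangles is [\sum N + \sum K], the two excesses distribute
   [5/4 n^2 (\sum_x d x) - 1/2 n^2 (number of ordered triangles) - walks5] over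
   the lone triangles and the K4s. *)
Definition lone_K3_excess u v : R :=
  n ^+ 2 * (5 / 4 / c u v - 1 / 2) - f u * f v / c u v + 240 * n * d u.

(** Two sides have codegree 1; let [k] be the inverse codegree of the third. The main terms then
    total [n^2 (1 + 5k/4)], while AM-GM bounds the products by [(1 + k) s^2 / 4], with [s^2] at most
    [4 n^2] up to the error. *)
Lemma lone_K3_excess_ge0 x y z : lone_K3 x y z ->
  0 <= lone_K3_excess x y + lone_K3_excess y z + lone_K3_excess z x.
Proof.
move=> t.
have s_le : f x + f y + f z <= 2 * n + 12 * (d x + d y + d z).
  by have := K3_walks2 t; rewrite -(ler_nat R) !(natrD, natrM).
have [dx dy dz] : [/\ d x <= n, d y <= n & d z <= n] by rewrite !ler_nat !deg_le.
have [fx fy fz] : [/\ 0 <= f x, 0 <= f y & 0 <= f z] by rewrite !ler0n.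
have [dx0 dy0 dz0] : [/\ 0 <= d x, 0 <= d y & 0 <= d z] by rewrite !ler0n.
have n0 : 0 <= n by rewrite ler0n.
pose s := f x + f y + f z; pose D := d x + d y + d z.
have s0 : 0 <= s by rewrite /s; lra.
have s2 : s ^+ 2 <= 4 * n ^+ 2 + 480 * n * D.
  have : s ^+ 2 <= (2 * n + 12 * D) ^+ 2 by rewrite lerXn2r ?nnegrE // /D; lra.
  (* The squared error is absorbed by [D <= 3n]: [480 = 48 + 144 * 3]. *)
  have : D * D <= D * (3 * n) by apply: ler_wpM2l; rewrite /D; lra.
  rewrite !expr2; lra.
have key u v w (k : R) : f u + f v + f w = s -> 0 <= k <= 1 ->
  k * (f u * f v) + (f u + f v) * f w <= n ^+ 2 * (1 + 5 / 4 * k) + 240 * n * D.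
  move=> suvw /andP[k0 k1].
  have fw0 : 0 <= f w by []. have fu0 : 0 <= f u by []. have fv0 : 0 <= f v by [].
  have e1 : 4 * ((f u + f v) * f w) <= s ^+ 2.
    by have := sqr_ge0 (f u + f v - f w); rewrite -suvw !expr2; lra.
  have e2 : 4 * (f u * f v) <= s ^+ 2.
    have := sqr_ge0 (f u - f v); have := mulr_ge0 (addr_ge0 fu0 fv0) fw0.
    by have := mulr_ge0 fw0 fw0; rewrite -suvw !expr2; lra.
  have nD : 0 <= n * D by rewrite mulr_ge0 // /D; lra.
  have := ler_wpM2l k0 e2; have := ler_wpM2l k0 s2.
  have := ler_wpM2l nD k1; have : 0 <= k * n ^+ 2 by rewrite mulr_ge0 ?sqr_ge0.
  lra.
(* Codegree 0 is harmless because [0^-1 = 0]. *)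
have cond u v : 0 <= (c u v)^-1 <= 1.
  rewrite invr_ge0 ler0n /=; case: (posnP (codeg u v)) => [->|c0]; first by rewrite invr0.
  by rewrite invf_le1 ?ltr0n // ler1n.
have t1 := t; rewrite lone_K3_rot in t1; have t2 := t1; rewrite lone_K3_rot in t2.
have := lone_K3_codeg t; have := lone_K3_codeg t1; have := lone_K3_codeg t2.
have kxy := key x y z _ erefl (cond x y).
have kyz := key y z x _ _ (cond y z).
have kzx := key z x y _ _ (cond z x).
have {}kyz := kyz ltac:(rewrite /s; ring).
have {}kzx := kzx ltac:(rewrite /s; ring).
rewrite /lone_K3_excess; move: kxy kyz kzx; rewrite /D.
set X := (c x y)^-1; set Y := (c y z)^-1; set Z := (c z x)^-1 => kxy kyz kzx h1 h2 h3.
have X1 : codeg x y = 1%N -> X = 1 by rewrite /X => ->; rewrite invr1.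
have Y1 : codeg y z = 1%N -> Y = 1 by rewrite /Y => ->; rewrite invr1.
have Z1 : codeg z x = 1%N -> Z = 1 by rewrite /Z => ->; rewrite invr1.
have : [\/ X = 1 /\ Y = 1, Y = 1 /\ Z = 1 | X = 1 /\ Z = 1].
  case: h1 => [/Z1 E1|/Y1 E1]; case: h2 => [/Y1 E2|/X1 E2]; case: h3 => [/X1 E3|/Z1 E3];
  by [apply: Or31 | apply: Or32 | apply: Or33].
case=> -[E1 E2]; move: kxy kyz kzx; rewrite E1 E2; lra.
Qed.

(** The factor [1/2] before the [K4] sum is cleared, so the main term is
    [2 (5/8 - 1/2) n^2 = n^2 / 4]. *)
Definition K4_excess u v : R := n ^+ 2 / 4 - f u * f v + 240 * n * d u.

Lemma K4_excess_ge0 x y z w : K4 x y z w ->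
  0 <= K4_excess x y + K4_excess y z + K4_excess z w + K4_excess w x
       + K4_excess x z + K4_excess y w.
Proof.
move=> k.
have s_le : f x + f y + f z + f w <= 2 * n + 12 * (d x + d y + d z + d w).
  by have := K4_walks2 k; rewrite -(ler_nat R) !(natrD, natrM).
have [dx dy dz dw] : [/\ d x <= n, d y <= n, d z <= n & d w <= n] by rewrite !ler_nat !deg_le.
have [fx fy fz fw] : [/\ 0 <= f x, 0 <= f y, 0 <= f z & 0 <= f w] by rewrite !ler0n.
have [dx0 dy0 dz0 dw0] : [/\ 0 <= d x, 0 <= d y, 0 <= d z & 0 <= d w] by rewrite !ler0n.
have n0 : 0 <= n by rewrite ler0n.
pose s := f x + f y + f z + f w; pose D := d x + d y + d z + d w.
have s0 : 0 <= s by rewrite /s; lra.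
have s2 : s ^+ 2 <= 4 * n ^+ 2 + 624 * (n * D).
  have : s ^+ 2 <= (2 * n + 12 * D) ^+ 2 by rewrite lerXn2r ?nnegrE // /D; lra.
  have : D * D <= D * (4 * n) by apply: ler_wpM2l; rewrite /D; lra.
  rewrite !expr2; lra.
(* The six products are largest when the four values agree. *)
have pairs : 8 * (f x * f y + f y * f z + f z * f w + f w * f x + f x * f z + f y * f w)
    <= 3 * s ^+ 2.
  have := sqr_ge0 (f x - f y); have := sqr_ge0 (f y - f z); have := sqr_ge0 (f z - f w).
  have := sqr_ge0 (f w - f x); have := sqr_ge0 (f x - f z); have := sqr_ge0 (f y - f w).
  rewrite /s !expr2; lra.
move: s2 pairs; rewrite /K4_excess /D.
have [nx ny nz nw] : [/\ 0 <= n * d x, 0 <= n * d y, 0 <= n * d z & 0 <= n * d w].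
  by rewrite !mulr_ge0.
lra.
Qed.

(** [sum_link] bounds the sum by four times the sum of squared degrees, which is the number of
    2-walks; hence [56 = 4 * 14]. *)
Lemma sum_K3_deg : \sum_x \sum_y \sum_z (K3 x y z)%:R * d x <= 56 * n ^+ 2.
Proof.
have -> : \sum_x \sum_y \sum_z (K3 x y z)%:R * d x
    = (\sum_x (\sum_(y | a x y) codeg x y) * deg x)%:R :> R.
  rewrite natr_sum; apply: eq_bigr => x _.
  rewrite natrM [in RHS]big_mkcond natr_sum big_distrl; apply: eq_bigr => y _ /=.
  rewrite -big_distrl -natr_sum /=; case xy: (a x y); first by rewrite sum_K3.
  by rewrite big1 // => z _; rewrite /K3 xy.
rewrite -natrX -natrM ler_nat.
apply: (@leq_trans (4 * \sum_x deg x ^ 2)%N).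
  rewrite big_distrr; apply: leq_sum => x _ /=.
  by rewrite -mulnn mulnA leq_mul2r sum_link orbT.
rewrite sum_sqr_deg -[56%N]/(4 * 14)%N -mulnA leq_mul2l /=.
apply: (@leq_trans (\sum_(x : V) 14 * #|V|)%N); first by apply: leq_sum => x _; exact: walks2_le.
by rewrite sum_nat_const mulnCA.
Qed.

Lemma walks5_le :
  walks5 <= n ^+ 2 * (5 / 4 * \sum_x d x - 1 / 2 * \sum_x \sum_y \sum_z (K3 x y z)%:R)
            + 240 * 56 * n ^+ 3.
Proof.
have HN := sum_lone_K3_ge0 lone_K3_excess_ge0.
have HK := sum_K4_ge0 K4_excess_ge0.
have mE : \sum_x d x = \sum_x \sum_y \sum_z N x y z / c x y
    + 2^-1 * \sum_x \sum_y \sum_z \sum_w K x y z w.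
  have -> : \sum_x d x = \sum_x \sum_y A x y * 1.
    by apply: eq_bigr => x _; rewrite sum_adj_const mulr1.
  rewrite sum_adj_split; congr (_ + _ * _).
    by do 3!(apply: eq_bigr => ? _); rewrite mul1r.
  by do 4!(apply: eq_bigr => ? _); rewrite mulr1.
have K3E (g : V -> R) : \sum_x \sum_y \sum_z (K3 x y z)%:R * g x =
   \sum_x \sum_y \sum_z N x y z * g x + \sum_x \sum_y \sum_z \sum_w K x y z w * g x.
  rewrite -big_split; apply: eq_bigr => x _; rewrite -big_split; apply: eq_bigr => y _.
  rewrite -big_split; apply: eq_bigr => z _ /=.
  by rewrite -big_distrl -natr_sum -mulrDl -natrD -K3_split.
have tE : \sum_x \sum_y \sum_z (K3 x y z)%:R = 
   \sum_x \sum_y \sum_z N x y z + \sum_x \sum_y \sum_z \sum_w K x y z w.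
  have := K3E (fun=> 1); congr (_ = _ + _).
  - by do 3!(apply: eq_bigr => ? _); rewrite mulr1.
  - by do 3!(apply: eq_bigr => ? _); rewrite mulr1.
  - by do 4!(apply: eq_bigr => ? _); rewrite mulr1.
have Kd0 : 0 <= \sum_x \sum_y \sum_z \sum_w K x y z w * d x.
  by do 4!(apply: sumr_ge0 => ? _); rewrite mulr_ge0.
have err := sum_K3_deg; rewrite K3E in err.
rewrite /walks5 sum_adj_split tE mE.
have {}HN : 0 <= n ^+ 2 * (5 / 4 * (\sum_x \sum_y \sum_z N x y z / c x y)
    - 1 / 2 * (\sum_x \sum_y \sum_z N x y z))
    - \sum_x \sum_y \sum_z N x y z * (f x * f y / c x y)
    + 240 * n * \sum_x \sum_y \sum_z N x y z * d x.
  apply: le_trans HN _; rewrite /lone_K3_excess le_eqVlt; apply/orP; left; apply/eqP.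
  rewrite !mulr_sumr -!sumrN -!big_split !mulr_sumr -!big_split; apply: eq_bigr => x _ /=.
  rewrite !mulr_sumr -!sumrN -!big_split !mulr_sumr -!big_split; apply: eq_bigr => y _ /=.
  rewrite !mulr_sumr -!sumrN -!big_split !mulr_sumr -!big_split; apply: eq_bigr => z _ /=.
  ring.
have {}HK : 0 <= n ^+ 2 / 4 * (\sum_x \sum_y \sum_z \sum_w K x y z w)
    - \sum_x \sum_y \sum_z \sum_w K x y z w * (f x * f y)
    + 240 * n * \sum_x \sum_y \sum_z \sum_w K x y z w * d x.
  apply: le_trans HK _; rewrite /K4_excess le_eqVlt; apply/orP; left; apply/eqP.
  rewrite !mulr_sumr -!sumrN -!big_split; apply: eq_bigr => x _ /=.
  rewrite !mulr_sumr -!sumrN -!big_split; apply: eq_bigr => y _ /=.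
  rewrite !mulr_sumr -!sumrN -!big_split; apply: eq_bigr => z _ /=.
  rewrite !mulr_sumr -!sumrN -!big_split; apply: eq_bigr => w _ /=.
  ring.
have n0 : 0 <= n by rewrite ler0n.
have := ler_wpM2l n0 err; have := mulr_ge0 n0 Kd0; move: HN HK.
rewrite (exprSr n 2); lra.
Qed.

(** This [D] makes [5 D^4 = 5/4 n^2], so the degree sums in the two bounds on [walks5] cancel. *)
Lemma sum_K3_le (D : R) : 0 < n -> 0 < D -> D ^+ 2 = n / 2 ->
  \sum_x \sum_y \sum_z (K3 x y z)%:R <= 2 * n * D + 480 * 56 * n.
Proof.
move=> n0 D0 D2.
have D4 : D ^+ 4 = n ^+ 2 / 4 by rewrite (exprM D 2 2) D2; field.
have := le_trans (walks5_ge D0) walks5_le; rewrite D4 => le54.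
rewrite -(ler_pM2l (exprn_gt0 2 n0)).
by move: le54; rewrite (exprSr n 2); lra.
Qed.

End Graph.

(** * Restriction to the edges that lie in triangles *)

Section Triangles.
Variables (V : finType) (E : {set {set V}}).
Hypotheses (simpleE : simple_graph E) (C5freeE : C5_free E).

Definition tri_adj : rel V :=
  fun x y => adj E x y && [exists z, adj E x z && adj E y z].

Lemma adj_sym : symmetric (adj E).
Proof. by move=> x y; rewrite /adj setUC. Qed.

Lemma adj_irr : irreflexive (adj E).
Proof.
move=> x; apply/negbTE/negP => xx.
by have /forallP/(_ _)/implyP/(_ xx) := simpleE; rewrite setUid cards1.
Qed.

Lemma tri_adj_sym : symmetric tri_adj.
Proof.
move=> x y; rewrite /tri_adj adj_sym; congr (_ && _).
by apply/existsP/existsP => -[z]; exists z; rewrite andbC.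
Qed.

Lemma tri_adj_irr : irreflexive tri_adj.
Proof. by move=> x; rewrite /tri_adj adj_irr. Qed.

Lemma tri_adj_adj x y : tri_adj x y -> adj E x y.
Proof. by case/andP. Qed.

Lemma tri_adj_triangle x y z :
  adj E x y -> adj E y z -> adj E x z -> tri_adj x y.
Proof. by move=> xy yz xz; rewrite /tri_adj xy; apply/existsP; exists z; rewrite xz yz. Qed.

(** A triangle keeps all its sides, since each side has the opposite vertex as witness. *)
Lemma tri_adj_tri x y : tri_adj x y -> exists z, tri_adj x z && tri_adj y z.
Proof.
case/andP=> xy /existsP[z /andP[xz yz]]; exists z; apply/andP; split.
  by apply: (tri_adj_triangle (z := y)); rewrite // adj_sym.
by apply: (tri_adj_triangle (z := x)); rewrite // adj_sym.
Qed.

Lemma tri_adj_C5 : no_C5 tri_adj.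
Proof.
move=> u v w x y /tri_adj_adj uv /tri_adj_adj vw /tri_adj_adj wx /tri_adj_adj xy /tri_adj_adj yu.
move=> /eqP uw /eqP ux /eqP vx /eqP vy /eqP wy.
have adj_neq p q : adj E p q -> p != q by move=> pq; apply/eqP => pqE; rewrite pqE adj_irr in pq.
have /negP := C5freeE; apply; apply/existsP; exists [tuple u; v; w; x; y].
rewrite /ucycleb /= !inE !negb_or uv vw wx xy yu uw ux vx vy wy.
by rewrite (adj_neq u v) // (adj_neq v w) // (adj_neq w x) // (adj_neq x y) // eq_sym (adj_neq y u).
Qed.

(** Each triangle has [3 * 2 * 1] orderings, recorded by [p], and an ordered triple determines its
    triangle. *)
Lemma card_triangles_K3 :
  6 * #|triangles E| <= \sum_x \sum_y \sum_z K3 tri_adj x y z.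
Proof.
pose p (T : {set V}) x y z := [&& x \in T, y \in T :\ x & z \in T :\ x :\ y].
have -> : 6 * #|triangles E| = \sum_(T in triangles E) \sum_x \sum_y \sum_z p T x y z.
  rewrite mulnC -sum_nat_const; apply: eq_bigr => T; rewrite inE => /andP[/eqP T3 _].
  rewrite -[6]/(3 * (2 * 1)) -T3 -sum_nat_const big_mkcond; apply: eq_bigr => x _.
  case: ifP => xT; last by rewrite big1 // => y _; rewrite big1 // => z _; rewrite /p xT.
  have T2 : #|T :\ x| = 2 by move: T3; rewrite (cardsD1 x) xT => -[].
  rewrite -T2 -sum_nat_const big_mkcond; apply: eq_bigr => y _.
  case: ifP => yT; last by rewrite big1 // => z _; rewrite /p yT andbF.
  have T1 : #|T :\ x :\ y| = 1 by move: T2; rewrite (cardsD1 y) yT => -[].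
  by rewrite -T1 -sum1_card big_mkcond; apply: eq_bigr => z _; rewrite /p xT yT; case: (z \in _).
rewrite exchange_big; apply: leq_sum => x _; rewrite exchange_big; apply: leq_sum => y _.
rewrite exchange_big; apply: leq_sum => z _ /=.
have pE T : T \in triangles E -> p T x y z -> (T = [set x; y; z]) /\ K3 tri_adj x y z.
  rewrite inE => /andP[/eqP T3 /forallP allT]; rewrite /p !inE.
  move=> /and3P[xT /andP[yx yT] /and3P[zy zx zT]].
  have tadj u v : u \in T -> v \in T -> u != v -> adj E u v.
    move=> uT vT uv.
    by have /implyP/(_ uT)/forallP/(_ v)/implyP/(_ vT)/implyP/(_ uv) := allT u.
  split.
    apply/esym/eqP; rewrite eqEcard T3; apply/andP; split.
      by apply/subsetP => u; rewrite !inE => /orP[/orP[]|] /eqP->.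
    by rewrite setUC cardsU1 cards2 !inE negb_or zx zy eq_sym yx.
  have [xy yz xz] : [/\ adj E x y, adj E y z & adj E x z] by split; apply: tadj; rewrite // eq_sym.
  apply/and3P; split.
  - exact: (tri_adj_triangle xy yz xz).
  - by apply: (tri_adj_triangle (z := x)); rewrite // adj_sym.
  - by apply: (tri_adj_triangle (z := y)); rewrite // adj_sym.
case k: (K3 tri_adj x y z); last first.
  by rewrite big1 // => T TE; case pT: (p T x y z) => //; have [_] := pE T TE pT; rewrite k.
case: (boolP ([set x; y; z] \in triangles E)) => TE.
  rewrite (bigD1 [set x; y; z]) //= big1 ?addn0 ?leq_b1 // => T /andP[T1 T2].
  by case pT: (p T x y z) => //; have [TE' _] := pE T T1 pT; rewrite TE' eqxx in T2.
rewrite big1 // => T T1; case pT: (p T x y z) => //.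
by have [TE' _] := pE T T1 pT; rewrite -TE' T1 in TE.
Qed.

End Triangles.

(* classical_sets shadows finset lemmas such as setUC, which are used above. *)
From mathcomp Require Import all_classical all_reals all_analysis.
Import Order.TTheory GRing.Theory Num.Theory numFieldNormedType.Exports.

(** * Asymptotics of the extremal number *)

Local Open Scope classical_set_scope.
Local Open Scope ring_scope.

Lemma ex_K3_C5_le (R : realType) (n : nat) : (0 < n)%N ->
  (ex_K3_C5 n)%:R <= n%:R * Num.sqrt n%:R / (3 * Num.sqrt 2) + 80 * 56 * n%:R :> R.
Proof.
move=> n0; have nR0 : 0 < n%:R :> R by rewrite ltr0n.
have s2 : 0 < Num.sqrt 2 :> R by rewrite sqrtr_gt0.
rewrite /ex_K3_C5; elim/big_ind: _ => [|p q|E /andP[simpleE C5E]].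
- by rewrite addr_ge0 ?divr_ge0 ?mulr_ge0 ?sqrtr_ge0 // ?ler0n.
- by move=> hp hq; rewrite /maxn; case: ifP.
(* This is [sqrt (n/2)], the value for which [sum_K3_le] holds; dividing by 6 turns [480 * 56] into
   [80 * 56]. *)
pose D : R := Num.sqrt n%:R / Num.sqrt 2.
have D0 : 0 < D by rewrite divr_gt0 ?sqrtr_gt0.
have D2 : D ^+ 2 = #|'I_n|%:R / 2.
  by rewrite card_ord /D expr_div_n !sqr_sqrtr ?ler0n // ltW.
have cn0 : 0 < #|'I_n|%:R :> R by rewrite card_ord.
have := sum_K3_le (tri_adj_sym E) (tri_adj_irr simpleE) (tri_adj_C5 simpleE C5E)
  (@tri_adj_tri _ E) cn0 D0 D2.
have := card_triangles_K3 E; rewrite -(ler_nat R) natrM natr_sum.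
under eq_bigr do (rewrite natr_sum; under eq_bigr do rewrite natr_sum).
rewrite card_ord => le6 leD.
have -> : n%:R * Num.sqrt n%:R / (3 * Num.sqrt 2) = n%:R * D / 3 :> R.
  by rewrite /D; field; rewrite gt_eqF.
have := le_trans le6 leD; lra.
Qed.

Theorem theorem1 (R : realType) :
  exists eps : nat -> R,
    (eps n @[n --> \oo] --> (0 : R)) /\
    (forall n : nat, (0 < n)%N ->
      (ex_K3_C5 n)%:R
        < (1 + eps n) * (1 / (3 * Num.sqrt 2)) * (n%:R `^ (3 / 2))).
Proof.
(* With this [C] the error term contributes [(80 * 56 + 1) n]; the extra [n] makes the inequality
   strict. *)
pose C : R := 3 * Num.sqrt 2 * (80 * 56 + 1).
exists (fun n => C / Num.sqrt n%:R); split.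
  rewrite -[X in _ --> X](mulr0 C); apply: cvgM; first exact: cvg_cst.
  apply/gtr0_cvgV0.
    by near=> n; rewrite sqrtr_gt0 ltr0n; near: n; exists 1%N.
  apply/cvgryPge => A; near=> n.
  have A2 : A ^+ 2 <= n%:R by near: n; exact: nbhs_infty_ger.
  by apply: le_trans (ler_norm A) _; rewrite -sqrtr_sqr ler_sqrt ?ler0n.
move=> n n0; have nR0 : 0 < n%:R :> R by rewrite ltr0n.
have s2 : 0 < Num.sqrt 2 :> R by rewrite sqrtr_gt0.
have sn : 0 < Num.sqrt n%:R :> R by rewrite sqrtr_gt0.
have -> : n%:R `^ (3 / 2) = n%:R * Num.sqrt n%:R :> R.
  rewrite (_ : 3 / 2 = 1 + 2^-1); last by field.
  by rewrite powRD ?powRr1 ?powR12_sqrt ?ler0n // gt_eqF // implybT.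
apply: le_lt_trans (ex_K3_C5_le R n0) _.
have -> : (1 + C / Num.sqrt n%:R) * (1 / (3 * Num.sqrt 2)) * (n%:R * Num.sqrt n%:R)
   = n%:R * Num.sqrt n%:R / (3 * Num.sqrt 2) + (80 * 56 + 1) * n%:R.
  by rewrite /C; field; rewrite !gt_eqF.
by rewrite ltrD2l ltr_pM2r // ltrDl.
Unshelve. all: by end_near.
Qed.
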